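(* Let $n\ge 3$ and $\ell>0$, and let $S=(n-2)I_n+\mathbf{1}_n\mathbf{1}_n^\top$. For every real symmetric diagonally dominant $n\times n$ matrix $J$ with $J_{ij}\ge \ell$ for all $i,j$, $J$ is invertible and $$\|J^{-1}\|_\infty\le \frac{1}{\ell}\|S^{-1}\|_\infty=\frac{3n-4}{2\ell(n-2)(n-1)}.$$ Moreover, equality holds if and only if $J=\ell S$.
   Context: $I_n$ is the $n\times n$ identity matrix and $\mathbf{1}_n$ the all-ones column vector in $\mathbb{R}^n$. For a real $n\times n$ matrix $J$, $\Delta_i(J)=|J_{ii}|-\sum_{j\ne i}|J_{ij}|$; $J$ is diagonally dominant if $\Delta_i(J)\ge 0$ for all $i$. $\|A\|_\infty$ denotes the maximum absolute row sum of $A$ (the operator norm induced by the $\ell^\infty$ vector norm). *)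

(* Defs.v *)
From HB Require Import structures.
From mathcomp Require Import all_boot all_order all_algebra.
Set Implicit Arguments. Unset Strict Implicit. Unset Printing Implicit Defensive.
Import Order.TTheory GRing.Theory Num.Theory.
Local Open Scope ring_scope.

Definition Delta (R : realFieldType) (n : nat) (J : 'M[R]_n) (i : 'I_n) : R :=
  `|J i i| - \sum_(j < n | j != i) `|J i j|.

Definition diag_dominant (R : realFieldType) (n : nat) (J : 'M[R]_n) : Prop :=
  forall i, 0 <= Delta J i.

(* ||A||_oo = maximum absolute row sum (row sums are >= 0, so 0 is a neutral
   start value for the max). *)
Definition infnorm (R : realFieldType) (m n : nat) (A : 'M[R]_(m, n)) : R :=
  \big[Num.max/0]_(i < m) \sum_(j < n) `|A i j|.

Definition ones (R : realFieldType) (n : nat) : 'cV[R]_n := const_mx 1.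

Definition Smat (R : realFieldType) (n : nat) : 'M[R]_n :=
  (n - 2)%:R *: 1%:M + ones R n *m (ones R n)^T.

(* Main.v *)
Require Import Defs.
From HB Require Import structures.
From mathcomp Require Import all_boot all_order all_algebra.
From mathcomp Require Import ring lra zify.
Import Order.TTheory GRing.Theory Num.Theory.
Local Open Scope ring_scope.

(** After scaling to l = 1, put k = n - 2, s = k / (3k + 2) and c = k (1 - s),
    so that 1 / c is the claimed bound. It suffices that |Jx|_oo >= c when
    x_(i0) = 1 = |x|_oo. Write J = S + P, so that
    (Px)_i = \sum_(j != i) P_ij (x_i + x_j) + Delta_i x_i with P_ij >= 0.
    If \sum x > - k s, row i0 alone exceeds c. Otherwise test Jx against
    the vector y with y_i = sign(x_i) when |x_i| > s and y_i = 0 elsewhere: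
    it is an odd nondecreasing function of x, hence y^T P x >= 0, and
    y^T S x >= c |y|_1. In the equality case y is 1 at i0 and -1 elsewhere, all
    the terms of y^T P x vanish, and the rows of Jx then force P = 0. *)

Definition threshold {R : realFieldType} (s t : R) : R :=
  if s < t then 1 else if t < - s then -1 else 0.

(** For [0 <= s] the map [threshold s] is odd and nondecreasing, so [a >= - b] gives
    [threshold s a >= - threshold s b], and likewise with both inequalities reversed. *)
Lemma threshold_add_sign (R : realFieldType) (s a b : R) :
  0 <= s -> 0 <= (a + b) * (threshold s a + threshold s b).
Proof.
move=> s0; rewrite /threshold.
by case: ltP => ?; case: ltP => ?; try case: ltP => ?; try case: ltP => ?; nra.
Qed.

Lemma threshold_mul_ge0 (R : realFieldType) (s a : R) :
  0 <= s -> 0 <= a * threshold s a.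
Proof. by move=> s0; rewrite /threshold; do 2?case: ltP => ?; nra. Qed.

Lemma sum_ge_two (R : realFieldType) (I : finType) (a : I -> R) (i j : I) :
  i != j -> (forall m, 0 <= a m) ->
  a i + a j <= \sum_m a m /\
  (\sum_m a m = a i + a j -> forall m, m != i -> m != j -> a m = 0).
Proof.
move=> ij a0; rewrite (bigD1 i) //= (bigD1 j) 1?eq_sym //=.
split; first by rewrite addrA lerDl sumr_ge0.
rewrite addrA -[RHS]addr0 => /addrI /psumr_eq0P H m mi mj.
by apply: H => //; rewrite mi.
Qed.

(** * Splitting [J] into [S] plus an excess *)

Section Excess.
Variables (R : realFieldType) (n : nat) (J : 'M[R]_n).
Hypothesis n3 : (3 <= n)%N.
Hypothesis Jsym : J^T = J.
Hypothesis Jdd : diag_dominant J.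
Hypothesis J1 : forall i j, 1 <= J i j.

Let k : R := (n - 2)%:R.

Lemma natr_sub2_gt0 : 0 < k.
Proof. by rewrite ltr0n; lia. Qed.

Lemma natr_sub2E : n%:R = k + 2.
Proof. by rewrite /k -natrD; congr (_ %:R); lia. Qed.

Let excess (x : 'I_n -> R) (i : 'I_n) : R :=
  \sum_(j | j != i) (J i j - 1) * (x i + x j) + Delta J i * x i.

(** Entries of [J] are positive, so [J i i] is [Delta J i] plus the off-diagonal row sum; the
    [k + 1] ones subtracted in [excess] account for the diagonal of [S]. *)
Lemma row_decomp (x : 'I_n -> R) i :
  \sum_j J i j * x j = k * x i + \sum_j x j + excess x i.
Proof.
have -> : \sum_j x j = x i + \sum_(j | j != i) x j by rewrite (bigD1 i).
have E : \sum_(j | j != i) (J i j - 1) * (x i + x j) =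
  (\sum_(j | j != i) J i j) * x i + \sum_(j | j != i) J i j * x j
  - (\sum_(j | j != i) 1) * x i - \sum_(j | j != i) x j.
  rewrite !mulr_suml -!sumrN -!big_split /=.
  by apply: eq_bigr => j _; ring.
have C : \sum_(j < n | j != i) 1 = k + 1 :> R.
  rewrite sumr_const (_ : #|_| = (n - 1)%N) ?cardC1 ?card_ord ?subn1 //.
  by rewrite /k natr1; congr (_ %:R); lia.
have D : Delta J i = J i i - \sum_(j | j != i) J i j.
  rewrite /Delta ger0_norm ?(le_trans ler01) //; congr (_ - _).
  by apply: eq_bigr => j _; rewrite ger0_norm ?(le_trans ler01).
rewrite /excess E C D (bigD1 i) //=; ring.
Qed.

(** Since [J] is symmetric, [i] and [j] can be exchanged in the double sum; adding both forms turns
    [y i] into [y i + y j], the shape handled by [threshold_add_sign]. *)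
Lemma excess_pairing (x y : 'I_n -> R) :
  2 * \sum_i y i * excess x i =
  \sum_i (\sum_(j | j != i) (J i j - 1) * ((x i + x j) * (y i + y j))
          + 2 * (Delta J i * (x i * y i))).
Proof.
have JC i j : J i j = J j i by rewrite -[in LHS]Jsym mxE.
pose A i j := (J i j - 1) * (x i + x j) * y i.
have sw : \sum_i \sum_(j | j != i) A i j = \sum_i \sum_(j | j != i) A j i.
  rewrite (exchange_big_dep predT) //=; apply: eq_bigr => i _.
  by apply: eq_bigl => j; rewrite eq_sym.
transitivity (\sum_i \sum_(j | j != i) A i j + \sum_i \sum_(j | j != i) A j i
              + 2 * \sum_i Delta J i * (x i * y i)).
  rewrite -sw [RHS](_ : _ = 2 * (\sum_i \sum_(j | j != i) A i j +
    \sum_i Delta J i * (x i * y i))); last by ring.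
  rewrite -big_split /=; congr (_ * _).
  apply: eq_bigr => i _; rewrite /excess mulrDr mulr_sumr; congr (_ + _).
    by apply: eq_bigr => j _; rewrite /A; ring.
  by ring.
rewrite mulr_sumr -!big_split /=; apply: eq_bigr => i _.
rewrite -big_split /=; congr (_ + _); apply: eq_bigr => j _.
by rewrite /A (JC j i); ring.
Qed.

(** * The constants, and the test-vector inequality for [S] *)

Let s : R := k / (3 * k + 2).
Let c : R := k * (1 - s).

(** By this equation [S] sends the vector with entry 1 at one index and [2 * s - 1] elsewhere to [c]
    at that index and [- c] elsewhere, the extremal configuration. *)
Lemma level_eq : 3 * k * s + 2 * s = k.
Proof. by have := natr_sub2_gt0; rewrite /s => ?; field; lra. Qed.

Lemma level_gt0 : 0 < s.
Proof. by have := natr_sub2_gt0; rewrite /s => ?; apply: divr_gt0; lra. Qed.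

Lemma level_lt : 3 * s < 1.
Proof. by have := natr_sub2_gt0; have := level_eq; have := level_gt0; nra. Qed.

Lemma bound_gt0 : 0 < c.
Proof.
have := natr_sub2_gt0; have := level_gt0; have := level_lt.
by move=> *; apply: mulr_gt0 => //; lra.
Qed.

(** Row [i] of [S x] is [k * x i + T], so this is the inequality [y^T S x >= c |y|_1] in the case
    left open by row [i0]. *)
Lemma threshold_test (x : 'I_n -> R) (i0 : 'I_n) (T := \sum_i x i)
    (y := fun i => threshold s (x i)) :
  x i0 = 1 -> T <= - (k * s) ->
  0 <= \sum_i (y i * (k * x i + T) - c * `|y i|) /\
  (\sum_i (y i * (k * x i + T) - c * `|y i|) = 0 ->
   T = - (k * s) /\ forall i, i != i0 -> x i < - s).
Proof.
move=> x0 Tk.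
have k0 := natr_sub2_gt0; have sE := level_eq; have s0 := level_gt0.
have s1 := level_lt.
have ks0 : 0 < k * s by rewrite mulr_gt0.
(* Otherwise [T >= 1 - (k + 1) * s > - (k * s)], because [s < 1]. *)
have [j jlt] : exists j, x j < - s.
  apply/existsP; apply: contraT => /existsPn H.
  have : \sum_(i | i != i0) - s <= \sum_(i | i != i0) x i.
    by apply: ler_sum => i _; rewrite leNgt H.
  rewrite sumr_const (_ : #|_| = (n - 2).+1); last first.
    by rewrite cardC1 card_ord; lia.
  rewrite -mulr_natl -natr1 -/k => ge.
  have : T = 1 + \sum_(i | i != i0) x i by rewrite /T (bigD1 i0) //= x0.
  by move=> TE; nra.
have ji0 : i0 != j by apply: contraTneq jlt => <-; rewrite x0; lra.
(* The terms of the sum, corrected by an affine function of [x m] whose total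
   is known, are nonnegative; the excess at [i0] and [j] pays the correction. *)
pose a m := y m * (k * x m + T) - c * `|y m| + (k * x m + (k - 3 * (k * s) - T)).
have a_neg m : x m < - s -> a m = - 2 * T - 2 * (k * s).
  move=> lt; rewrite /a /y /threshold ltNge lt ltW /=; last by lra.
  by rewrite normrN1 /c; ring.
have a_pos m : s < x m -> a m = 2 * (k * x m) - 2 * (k * s).
  by move=> lt; rewrite /a /y /threshold lt normr1 /c; ring.
(* Here [y m = 0], and [x m >= - s] with [T <= - (k * s)] leaves at least [k * (1 - 3 * s)]. *)
have a_mid m : x m <= s -> - s <= x m -> 0 < a m.
  move=> le ge; rewrite /a /y /threshold !ltNge le ge /= normr0.
  by nra.
have apos m : ~ (x m < - s) -> 0 < a m.
  move=> /negP; rewrite -leNgt => ge.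
  have [le|lt] := leP (x m) s; first exact: a_mid.
  by rewrite a_pos //; nra.
have a0 m : 0 <= a m.
  have [lt|ge] := ltP (x m) (- s); first by rewrite a_neg //; lra.
  by apply/ltW/apos/negP; rewrite -leNgt.
have [le eq] := sum_ge_two _ _ a i0 j ji0 a0.
(* The corrections add up to [k * T + (k + 2) * (k - 3 * (k * s) - T)], which equals [a i0 + a j] by
   [level_eq], used both as it is and multiplied by [k]. *)
have Ea : \sum_m a m =
    \sum_i (y i * (k * x i + T) - c * `|y i|) - (a i0 + a j) * -1.
  rewrite (a_neg j) // (a_pos i0) ?x0; last by lra.
  rewrite /a big_split /= [X in _ + X]big_split /= -mulr_sumr -/T.
  rewrite sumr_const card_ord -[_ *+ n]mulr_natl natr_sub2E.
  have := congr1 (fun z => k * z) sE; rewrite /=.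
  by set W := (\sum_i _); nra.
split; first lra.
move=> W0; have {}eq := eq ltac:(lra).
have neg i : i != i0 -> x i < - s.
  have [-> //|ij ii0] := eqVneq i j.
  apply/negPn; apply/negP => /negP /apos; rewrite eq ?ltxx //.
split=> //.
(* As [n >= 3] there is a third index [m]; its entry is below [- s], so [a m = 0] reads
   [T = - (k * s)]. *)
have [m /andP[mi mj]] : exists m : 'I_n, (m != i0) && (m != j).
  apply/existsP; apply: contraT => /existsPn H.
  have : (#|'I_n| <= #|[set i0; j]|)%N.
    apply: subset_leq_card; apply/subsetP => m _; rewrite !inE.
    by have := H m; rewrite negb_and !negbK.
  by rewrite card_ord cards2 ji0; lia.
by have := eq m mi mj; rewrite a_neg ?neg //; lra.
Qed.

(** * The estimate for a normalized vector and its equality case *)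

Lemma normalized_bound (x : 'I_n -> R) (i0 : 'I_n) (b : R) :
  x i0 = 1 -> (forall i, `|x i| <= 1) ->
  (forall i, `|\sum_j J i j * x j| <= b) ->
  c <= b /\ (b = c -> J = Smat R n).
Proof.
move=> x0 x1 Jb.
have k0 := natr_sub2_gt0; have sE := level_eq; have s0 := level_gt0.
have s1 := level_lt.
have ks0 : 0 < k * s by rewrite mulr_gt0.
have x1' i : -1 <= x i by have := x1 i; rewrite ler_norml => /andP[].
pose T := \sum_i x i.
have P0 i j : 0 <= J i j - 1 by rewrite subr_ge0.
have e0 j : j != i0 -> 0 <= (J i0 j - 1) * (x i0 + x j).
  by move=> _; rewrite mulr_ge0 // x0; have := x1' j; lra.
have e1 : 0 <= \sum_(j | j != i0) (J i0 j - 1) * (x i0 + x j).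
  exact: sumr_ge0.
have e2 := Jdd i0.
have row0 : k + T + excess x i0 <= b.
  apply: le_trans (Jb i0); apply: le_trans (ler_norm _).
  by rewrite row_decomp x0 mulr1.
have ex0 : excess x i0 =
  \sum_(j | j != i0) (J i0 j - 1) * (x i0 + x j) + Delta J i0.
  by rewrite /excess {2}x0 mulr1.
have [Tk|Tk] := ltP (- (k * s)) T.
  have lt : c < b by rewrite /c; lra.
  by split; [exact: ltW | move=> E; rewrite E ltxx in lt].
have [W0 Weq] := threshold_test x i0 x0 Tk.
pose y i := threshold s (x i).
rewrite -/T -/(y _) in W0 Weq.
have P1 m j : 0 <= (J m j - 1) * ((x m + x j) * (y m + y j)).
  by apply: mulr_ge0 => //; exact/threshold_add_sign/ltW.
have D1 m : 0 <= Delta J m * (x m * y m).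
  by apply: mulr_ge0 => //; exact/threshold_mul_ge0/ltW.
have yexc : 0 <= \sum_i y i * excess x i.
  suff : 0 <= 2 * \sum_i y i * excess x i by lra.
  rewrite excess_pairing; apply: sumr_ge0 => i _; apply: addr_ge0.
    exact: sumr_ge0.
  exact: mulr_ge0.
have yJ : \sum_i y i * \sum_j J i j * x j <= b * \sum_i `|y i|.
  rewrite mulr_sumr; apply: ler_sum => i _.
  apply: le_trans (ler_norm _) _; rewrite normrM mulrC.
  exact: ler_wpM2r.
have yE : \sum_i y i * \sum_j J i j * x j - c * \sum_i `|y i| =
  \sum_i (y i * (k * x i + T) - c * `|y i|) + \sum_i y i * excess x i.
  rewrite mulr_sumr -sumrB -big_split /=; apply: eq_bigr => i _.
  by rewrite row_decomp -/T; ring.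
have y1 : 1 <= \sum_i `|y i|.
  rewrite (bigD1 i0) //= {1}/y /threshold x0 ifT; last by lra.
  by rewrite normr1 lerDl sumr_ge0.
(* Together [yJ] and [yE] give [(b - c) * |y|_1 >= 0], and [|y|_1] is positive by [y1]. *)
split; first by nra.
move=> bc; rewrite bc in yJ Jb row0.
have {Weq}[Teq neg] := Weq ltac:(lra).
have yex0 : \sum_i y i * excess x i = 0 by lra.
have y_i0 : y i0 = 1 by rewrite /y /threshold x0 ifT //; lra.
have y_neg i : i != i0 -> y i = -1.
  by move=> /neg lt; rewrite /y /threshold lt ltNge ltW //; lra.
have pair0 : forall i, \sum_(j | j != i) (J i j - 1) * ((x i + x j) * (y i + y j)) = 0
    /\ Delta J i = 0.
  have := excess_pairing x y; rewrite yex0 mulr0 => /esym H i.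
  have t1 m : 0 <= \sum_(j | j != m) (J m j - 1) * ((x m + x j) * (y m + y j)).
    exact: sumr_ge0.
  have E : \sum_(j | j != i) (J i j - 1) * ((x i + x j) * (y i + y j)) +
      2 * (Delta J i * (x i * y i)) = 0.
    apply: (psumr_eq0P _ H) => // m _.
    by rewrite addr_ge0 // mulr_ge0 // ler0n.
  have := t1 i; have := D1 i.
  move=> t2i t1i; split; first by lra.
  have xy : x i * y i != 0.
    have [->|ii0] := eqVneq i i0; first by rewrite x0 y_i0 mulr1 oner_neq0.
    by rewrite y_neg // mulrN1 oppr_eq0 lt_eqF // (lt_trans (neg i ii0)) // oppr_lt0.
  have /eqP : Delta J i * (x i * y i) = 0 by lra.
  by rewrite mulf_eq0 (negPf xy) orbF => /eqP.
have D0 i : Delta J i = 0 by case: (pair0 i).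
(* Away from [i0] both [x i + x j] and [y i + y j] are negative, so the vanishing pair term forces
   [J i j = 1]. *)
have offneg i j : i != i0 -> j != i0 -> j != i -> J i j = 1.
  move=> ii0 ji0 ji; have [H _] := pair0 i.
  have /eqP := psumr_eq0P (fun m _ => P1 i m) H ji; rewrite !y_neg //.
  have nz : (x i + x j) * (-1 + -1) != 0.
    by rewrite gt_eqF //; have := neg i ii0; have := neg j ji0; nra.
  by rewrite mulf_eq0 (negPf nz) orbF subr_eq0 => /eqP.
(* Now [y i0 + y j = 0], so the pairing says nothing. Row [i0] does: its excess must vanish, so
   [J i0 j = 1] or [x j = -1]. In the latter case row [j] has no excess and equals
   [- k - k * s < - c], a contradiction. *)
have off0 j : j != i0 -> J i0 j = 1.
  move=> ji0.
  have H : \sum_(j | j != i0) (J i0 j - 1) * (x i0 + x j) = 0.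
    by rewrite /c in row0; lra.
  have /eqP := psumr_eq0P e0 H ji0.
  rewrite mulf_eq0 subr_eq0 => /orP[/eqP //|/eqP xj].
  have J0j : J j i0 = J i0 j by rewrite -[in LHS]Jsym mxE.
  have exj : excess x j = 0.
    rewrite /excess D0 mul0r addr0 big1 // => m mj.
    have [->|mi0] := eqVneq m i0; first by rewrite [x j + _]addrC xj mulr0.
    by rewrite offneg // subrr mul0r.
  have := Jb j; rewrite row_decomp -/T exj ler_norml => /andP[+ _].
  by rewrite /c Teq; rewrite x0 in xj; nra.
have off i j : j != i -> J i j = 1.
  move=> ji; have [ii0|ii0] := eqVneq i i0; first by rewrite ii0 off0 // -ii0.
  have [ji0|ji0] := eqVneq j i0; last exact: offneg.
  by rewrite -[J]Jsym mxE ji0 off0.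
apply/matrixP => i j; rewrite !mxE big_ord1 !mxE mulr1.
have [ij|ij] := eqVneq i j; last by rewrite mulr0 add0r off // eq_sym.
rewrite -{j}ij mulr1.
have := D0 i; rewrite /Delta ger0_norm ?(le_trans ler01) //.
rewrite (eq_bigr (fun=> 1)); last by move=> j ji; rewrite off // normr1.
rewrite sumr_const (_ : #|_| = (n - 2).+1); last first.
  by rewrite cardC1 card_ord; lia.
by move/eqP; rewrite subr_eq0 => /eqP ->; rewrite -natr1.
Qed.

(** Dividing by the entry of largest absolute value reduces to the normalized case; [0 < b] excludes
    [x = 0] from the equality clause. *)
Lemma solution_bound (x : 'I_n -> R) (b : R) :
  (forall i, `|\sum_j J i j * x j| <= b) ->
  forall i, c * `|x i| <= b /\ (0 < b -> c * `|x i| = b -> J = Smat R n).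
Proof.
move=> Jb i.
have c0 := bound_gt0.
have b0 : 0 <= b by apply: le_trans (Jb i).
case: (@Order.TotalTheory.arg_maxP _ _ _ i predT (fun i => `|x i|) isT).
move=> i0 _ maxi0; have max j : `|x j| <= `|x i0| := maxi0 j isT.
have [x0|x0] := eqVneq (x i0) 0.
  have -> : `|x i| = 0 by apply/le_anti; rewrite normr_ge0 -(normr0 R) -x0 max.
  by rewrite mulr0; split=> // b0' E; rewrite -E ltxx in b0'.
have m0 : 0 < `|x i0| by rewrite normr_gt0.
have [] := normalized_bound (fun j => x j / x i0) i0 (b / `|x i0|).
- by rewrite divff.
- by move=> j; rewrite normrM normfV ler_pdivrMr // mul1r max.
- move=> j; rewrite (eq_bigr (fun m => J j m * x m / x i0)); last first.
    by move=> m _; rewrite mulrA.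
  by rewrite -mulr_suml normrM normfV ler_pM2r ?invr_gt0.
rewrite ler_pdivlMr // => le eq; have lei : c * `|x i| <= c * `|x i0|.
  by rewrite ler_pM2l // max.
split; first exact: le_trans lei le.
move=> _ E; apply: eq.
have -> : b = c * `|x i0| by lra.
by rewrite mulfK ?gt_eqF.
Qed.

(** * Invertibility and the norm of the inverse *)

Lemma dominant_unitmx : J \in unitmx.
Proof.
rewrite unitmxE unitfE; apply/det0P => -[v v0 vJ].
have c0 := bound_gt0.
case/negP: v0; apply/eqP/rowP => i; rewrite mxE.
(* A kernel vector satisfies the bound with [b = 0], hence vanishes. *)
have [|le _] := solution_bound (fun j => v 0 j) 0 _ i.
  move=> m; rewrite (eq_bigr (fun j => v 0 j * J j m)); last first.
    by move=> j _; rewrite mulrC -[in LHS]Jsym mxE.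
  by have /rowP/(_ m) := vJ; rewrite !mxE => ->; rewrite normr0.
by apply/eqP; rewrite -normr_le0; rewrite pmulr_rle0 in le.
Qed.

Lemma infnorm_inv_bound :
  infnorm (invmx J) <= c^-1 /\ (infnorm (invmx J) = c^-1 -> J = Smat R n).
Proof.
have c0 := bound_gt0.
have row i : c * (\sum_j `|invmx J i j|) <= 1 /\
    (c * (\sum_j `|invmx J i j|) = 1 -> J = Smat R n).
  (* With the signs of row [i] as right-hand side, entry [i] of the solution is the absolute row
     sum. *)
  pose u := \col_j Num.sg (invmx J i j).
  pose x := invmx J *m u.
  have xi : `|x i 0| = \sum_j `|invmx J i j|.
    rewrite -[RHS]ger0_norm ?sumr_ge0 //; congr `|_|.
    by rewrite mxE; apply: eq_bigr => j _; rewrite mxE mulrC -normrEsg.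
  have [|le eq] := solution_bound (fun j => x j 0) 1 _ i.
    move=> m; have -> : \sum_j J m j * x j 0 = (J *m x) m 0 by rewrite [RHS]mxE.
    rewrite /x mulKVmx ?dominant_unitmx // mxE normr_sg.
    by case: (_ != 0) => /=; lra.
  by rewrite xi in le eq; split=> // E; apply: eq.
have cV0 : 0 < c^-1 by rewrite invr_gt0.
split.
  apply: bigmax_le => [|i _]; first exact: ltW.
  by have [le _] := row i; rewrite -[c^-1]mulr1 ler_pdivlMl.
(* Some row attains the maximum: the default value 0 is itself below [c^-1]. *)
move=> E; have [i /eqP Ei] : exists i, \sum_j `|invmx J i j| == c^-1.
  apply/existsP; apply: contraT => /existsPn H.
  suff : infnorm (invmx J) < c^-1 by rewrite E ltxx.
  apply: bigmax_lt => // i _; have [le _] := row i.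
  by rewrite lt_neqAle H -[c^-1]mulr1 ler_pdivlMl.
by have [_] := row i; rewrite Ei divff ?gt_eqF //; apply.
Qed.

End Excess.

(** * The inverse of [S] and its norm *)

Lemma invmx_eq (R : comUnitRingType) (n : nat) (A B : 'M[R]_n) :
  A *m B = 1%:M -> invmx A = B.
Proof.
move=> AB; have [uA _] := mulmx1_unit AB.
by rewrite -[B](mulKmx uA) AB mulmx1.
Qed.

Lemma invmx_scale (R : fieldType) (n : nat) (a : R) (A : 'M[R]_n) :
  a != 0 -> A \in unitmx -> invmx (a *: A) = a^-1 *: invmx A.
Proof.
move=> a0 uA; apply: invmx_eq.
by rewrite -scalemxAl -scalemxAr scalerA mulfV // scale1r mulmxV.
Qed.

Lemma infnorm_scale (R : realFieldType) (m n : nat) (a : R) (A : 'M[R]_(m, n)) :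
  infnorm (a *: A) = `|a| * infnorm A.
Proof.
rewrite /infnorm (big_morph ( *%R `|a|) (fun x y => maxr_pMr x y (normr_ge0 a))
  (mulr0 _)).
apply: eq_bigr => i _; rewrite mulr_sumr; apply: eq_bigr => j _.
by rewrite mxE normrM.
Qed.

(** The all-ones matrix [E] satisfies [E *m E = n E], so [k I + E] has inverse
    [k^-1 (I - E / (k + n))], where [k + n = 2 * (k + 1)]. *)
Lemma Smat_mul_inv (R : realFieldType) (n : nat) (k : R := (n - 2)%:R) :
  (3 <= n)%N ->
  Smat R n *m (k^-1 *: (1%:M - (2 * (k + 1))^-1 *: const_mx 1)) = 1%:M.
Proof.
move=> n3; have k0 : 0 < k by exact: natr_sub2_gt0.
have U : ones R n *m (ones R n)^T = const_mx 1.
  by apply/matrixP => i j; rewrite !mxE big_ord1 !mxE mulr1.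
pose E : 'M[R]_n := const_mx 1.
have UU : E *m E = (k + 2) *: E.
  apply/matrixP => i j; rewrite !mxE (eq_bigr (fun=> 1)) => [|m _].
    by rewrite sumr_const card_ord -(natr_sub2E R n n3) mulr1.
  by rewrite !mxE mulr1.
rewrite /Smat U -/E -/k -scalemxAr mulmxDl !mulmxBr !mulmx1 -!scalemxAl mul1mx.
rewrite -!scalemxAr UU; apply/matrixP => i j; rewrite !mxE.
by field; lra.
Qed.

Lemma infnorm_Smat_inv (R : realFieldType) (n : nat) (k : R := (n - 2)%:R) :
  (3 <= n)%N -> infnorm (invmx (Smat R n)) = (3 * k + 2) / (2 * k * (k + 1)).
Proof.
move=> n3; have k0 : 0 < k by exact: natr_sub2_gt0.
rewrite (invmx_eq _ _ _ _ (Smat_mul_inv R n n3)) -/k.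
(* Diagonal entries of the inverse are nonnegative and the [k + 1] others in a row are negative, so
   all absolute row sums agree. *)
have row i : \sum_j `|(k^-1 *: (1%:M - (2 * (k + 1))^-1 *: const_mx 1)
    : 'M[R]_n) i j| = (3 * k + 2) / (2 * k * (k + 1)).
  have a0 : 0 < (2 * (k + 1))^-1 by rewrite invr_gt0; lra.
  have a1 : (2 * (k + 1))^-1 <= 1 by rewrite invf_le1; lra.
  rewrite (bigD1 i) //= (eq_bigr (fun=> k^-1 * (2 * (k + 1))^-1)); last first.
    move=> j ji; rewrite !mxE eq_sym (negPf ji) sub0r mulr1 normrM normrN.
    by rewrite (gtr0_norm a0) gtr0_norm ?invr_gt0.
  rewrite !mxE eqxx mulr1 normrM gtr0_norm ?invr_gt0 // ger0_norm ?subr_ge0 //.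
  rewrite sumr_const (_ : #|_| = (n - 2).+1); last first.
    by rewrite cardC1 card_ord; lia.
  rewrite -[_ *+ (n - 2).+1]mulr_natl -natr1 -/k /=.
  by field; lra.
have r0 : 0 <= (3 * k + 2) / (2 * k * (k + 1)) by apply: divr_ge0; nra.
apply/le_anti/andP; split; first by apply: bigmax_le => // i _; rewrite row.
have i : 'I_n by exists 0%N; lia.
by rewrite -(row i) /infnorm; exact: le_bigmax.
Qed.

(** * Scaling back to general [l] *)

Theorem theorem1 (R : realFieldType) (n : nat) (l : R) (J : 'M[R]_n) :
  (3 <= n)%N -> 0 < l ->
  J^T = J -> diag_dominant J -> (forall i j, l <= J i j) ->
  [/\ J \in unitmx,
      Smat R n \in unitmx,
      infnorm (invmx J) <= infnorm (invmx (Smat R n)) / l,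
      infnorm (invmx (Smat R n)) / l
        = (3 * n - 4)%:R / (2%:R * l * (n - 2)%:R * (n - 1)%:R)
    & (infnorm (invmx J) = infnorm (invmx (Smat R n)) / l <-> J = l *: Smat R n)].
Proof.
move=> n3 l0 Jsym Jdd Jl.
have k0 := natr_sub2_gt0 R n n3; set k : R := (n - 2)%:R in k0.
have l1 : l != 0 by rewrite gt_eqF.
pose K := l^-1 *: J.
have JK : J = l *: K by rewrite scalerA mulfV // scale1r.
have Ksym : K^T = K by rewrite linearZ /= Jsym.
have Kdd : diag_dominant K.
  move=> i; rewrite /Delta (eq_bigr (fun j => l^-1 * `|J i j|)) => [|j _].
    rewrite mxE normrM gtr0_norm ?invr_gt0 // -mulr_sumr -mulrBr.
    by apply: mulr_ge0; [rewrite invr_ge0 ltW | exact: Jdd].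
  by rewrite mxE normrM gtr0_norm ?invr_gt0.
have K1 i j : 1 <= K i j by rewrite mxE mulrC ler_pdivlMr // mul1r.
have uK := dominant_unitmx R n K n3 Ksym Kdd K1.
have [uS _] := mulmx1_unit (Smat_mul_inv R n n3).
have SE := infnorm_Smat_inv R n n3; rewrite -/k in SE.
(* The constant [c^-1] of the section is the norm of the inverse of [S]. *)
have cE : (k * (1 - k / (3 * k + 2)))^-1 = infnorm (invmx (Smat R n)).
  by rewrite SE; field; rewrite !gt_eqF //=; nra.
have [le eq] := infnorm_inv_bound R n K n3 Ksym Kdd K1.
rewrite -/k cE in le eq.
have JE : infnorm (invmx J) = infnorm (invmx K) / l.
  by rewrite JK invmx_scale // infnorm_scale gtr0_norm ?invr_gt0 // mulrC.
split=> //.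
- by rewrite JK unitmxZ ?unitfE.
- by rewrite JE ler_pM2r ?invr_gt0.
- rewrite SE (_ : (3 * n - 4)%:R = 3 * k + 2); last first.
    by rewrite -natrM -natrD; congr (_ %:R); lia.
  rewrite (_ : (n - 1)%:R = k + 1); last by rewrite natr1; congr (_ %:R); lia.
  by field; rewrite l1 !gt_eqF //=; lra.
split=> [|E].
  rewrite JE => /(mulIf _) H; rewrite JK; congr (_ *: _); apply/eq/H.
  by rewrite invr_neq0.
by rewrite JE /K E scalerA mulVf // scale1r.
Qed.
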